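(* Let $k\ge 1$ and $l\ge 1$ be integers, let $\mu'=(\mu'_1,\ldots,\mu'_k)$ be a partition, and let $\mu=(\mu'_1,\ldots,\mu'_k,1^l)$ be the partition obtained by appending $l$ parts equal to $1$. For a filling $T$ of shape $\mu$, let $T'$ be the filling of shape $\mu'$ given by $T'_{i,j}=T_{i,j}$ for $(i,j)\in\mu'$, and let $T''$ be the filling of shape $(1^l)$ given by $T''_{i,1}=T_{k+i,1}$ for $1\le i\le l$. Then for every filling $T$ of shape $\mu$, \[ \operatorname{maj}(T)\equiv \operatorname{maj}(T')+\operatorname{maj}(T'')\pmod{l} \quad\text{and}\quad \operatorname{inv}(T)=\operatorname{inv}(T')+\operatorname{inv}(T''). \]
   Context: Diagrams are in French convention: the diagram of a partition $\lambda=(\lambda_1\ge\cdots\ge\lambda_r>0)$ is the set of cells $(i,j)$ with $1\le i\le r$, $1\le j\le\lambda_i$ (row $i$ counted from the bottom, column $j$ from the left). For a cell $u=(i,j)$, $\operatorname{arm}(u)=\lambda_i-j$ is the number of cells strictly to its right and $\operatorname{leg}(u)$ is the number of cells of the diagram strictly above it in column $j$. A filling $T$ of shape $\lambda$ assigns a positive integer $T_{i,j}$ to each cell, with no monotonicity condition. A descent of $T$ is a cell $(i,j)$ with $i\ge 2$ and $T_{i,j}>T_{i-1,j}$; $\operatorname{Des}(T)$ is the set of descents and $\operatorname{maj}(T)=\sum_{u\in\operatorname{Des}(T)}(\operatorname{leg}(u)+1)$. Two distinct cells attack each other if they lie in the same row, or if they are of the form $(i,k)$ and $(i-1,j)$ with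 $j<k$ (consecutive rows, the upper cell strictly to the right of the lower one). The reading order reads rows from top to bottom and each row from left to right. A pair $(u,v)$ of cells is an inversion if $u,v$ attack each other, $T_u<T_v$, and $v$ precedes $u$ in the reading order; $\operatorname{Inv}(T)$ denotes the number of inversions, and $\operatorname{inv}(T)=\operatorname{Inv}(T)-\sum_{u\in\operatorname{Des}(T)}\operatorname{arm}(u)$. These statistics are computed with respect to the shape of the filling in question ($\mu$, $\mu'$ or $(1^l)$). *)

(* Defs.v *)
From mathcomp Require Import all_boot all_order all_algebra.

Set Implicit Arguments.
Unset Strict Implicit.
Unset Printing Implicit Defensive.


Definition is_partition (la : seq nat) : bool := sorted geq la && (0 \notin la).

(* A cell is (row, column), both numbered from 1. *)
Definition cell : Type := (nat * nat)%type.

Definition row_len (la : seq nat) (i : nat) : nat := nth 0 la i.-1.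

Definition diagram (la : seq nat) : seq cell :=
  [seq (i, j) | i <- iota 1 (size la), j <- iota 1 (row_len la i)].

Definition arm (la : seq nat) (u : cell) : nat := row_len la u.1 - u.2.

Definition leg (la : seq nat) (u : cell) : nat :=
  count (fun v : cell => (v.2 == u.2) && (u.1 < v.1)) (diagram la).

(* The values of [entry] outside [diagram la] are irrelevant: all the
   statistics below only look at cells of the diagram. *)
Record filling (la : seq nat) : Type := Filling {
  entry :> cell -> nat;
  entry_gt0 : forall u : cell, u \in diagram la -> 0 < entry u
}.

Definition Des (la : seq nat) (T : filling la) : seq cell :=
  [seq u <- diagram la | (2 <= u.1) && (T (u.1.-1, u.2) < T u)].

Definition maj (la : seq nat) (T : filling la) : nat :=
  \sum_(u <- Des T) (leg la u + 1).

(* [u] is in the row just above that of [v], strictly to the right of [v]. *)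
Definition upper_right (u v : cell) : bool := (u.1 == v.1.+1) && (v.2 < u.2).

Definition attack (u v : cell) : bool :=
  (u != v) && [|| u.1 == v.1, upper_right u v | upper_right v u].

(* Reading order: top row (largest row index) first, left to right in a row. *)
Definition precedes (v u : cell) : bool :=
  (u.1 < v.1) || ((v.1 == u.1) && (v.2 < u.2)).

Definition inversions (la : seq nat) (T : filling la) : seq (cell * cell) :=
  [seq p <- [seq (u, v) | u <- diagram la, v <- diagram la] |
    [&& attack p.1 p.2, T p.1 < T p.2 & precedes p.2 p.1]].

Definition Inv (la : seq nat) (T : filling la) : nat := size (inversions T).

Definition inv_stat (la : seq nat) (T : filling la) : int :=
  ((Inv T)%:Z - (\sum_(u <- Des T) arm la u)%:Z)%R.

(* Main.v *)
Require Import Defs.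
From mathcomp Require Import all_boot all_order all_algebra.
From mathcomp Require Import zify.

Set Implicit Arguments.
Unset Strict Implicit.
Unset Printing Implicit Defensive.

(** Let [la ++ nu] be the shape obtained by placing [nu] on top of [la].  Every
    cell of [la] gains the height of its column in [nu] as extra leg, and the
    descents of [T] seen neither by [T'] nor by [T''] sit in the bottom row of
    [nu], where leg plus one is again the height of the column in [nu].  Hence
    the defect of [maj] is a sum of column heights of [nu], all of which are
    multiples of [l] when [nu = 1^l].  The defect of [inv] counts the inversions
    across the junction minus the arms of the descents there; both vanish when
    [nu] has a single column. *)

Definition raise (k : nat) (u : cell) : cell := (k + u.1, u.2).

Definition column_height (la : seq nat) (j : nat) : nat :=
  count (fun u : cell => u.2 == j) (diagram la).

Definition is_descent (f : cell -> nat) (u : cell) : bool :=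
  (2 <= u.1) && (f (u.1.-1, u.2) < f u).

Definition is_inversion (f : cell -> nat) (u v : cell) : bool :=
  [&& attack u v, f u < f v & precedes v u].

Definition junction_descents (f : cell -> nat) (la nu : seq nat) : seq cell :=
  [seq u <- diagram nu | (u.1 == 1) && is_descent f (raise (size la) u)].

Definition junction_Inv (f : cell -> nat) (la nu : seq nat) : nat :=
  \sum_(u <- diagram la) \sum_(v <- diagram nu)
    is_inversion f u (raise (size la) v).

Lemma sorted_nseq (A : Type) (r : rel A) (n : nat) (x : A) :
  reflexive r -> sorted r (nseq n x).
Proof.
by move=> r_refl; case: n => // n; elim: n => //= n ->; rewrite r_refl.
Qed.

Lemma mem_diagram (la : seq nat) (u : cell) :
  (u \in diagram la) = (0 < u.1 <= size la) && (0 < u.2 <= row_len la u.1).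
Proof.
case: u => i j /=; rewrite /diagram; apply/allpairsPdep/idP.
  by case=> x [y []]; rewrite !mem_iota => hx hy [-> ->]; lia.
by case/andP=> hi hj; exists i, j; rewrite !mem_iota; split=> //; lia.
Qed.

Lemma row_len_cat (la nu : seq nat) (i : nat) :
  0 < i <= size la -> row_len (la ++ nu) i = row_len la i.
Proof. by move=> hi; rewrite /row_len nth_cat ifT //; lia. Qed.

Lemma row_len_cat_raise (la nu : seq nat) (i : nat) :
  0 < i -> row_len (la ++ nu) (size la + i) = row_len nu i.
Proof.
move=> hi; rewrite /row_len nth_cat ifF; last by lia.
by congr nth; lia.
Qed.

Lemma diagram_cat (la nu : seq nat) :
  diagram (la ++ nu) = diagram la ++ map (raise (size la)) (diagram nu).
Proof.
rewrite /diagram size_cat iotaD map_cat flatten_cat; congr (_ ++ _).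
  congr flatten; apply/eq_in_map => i; rewrite mem_iota => hi.
  by rewrite row_len_cat //; lia.
rewrite map_allpairs addnC iotaDl -map_comp; congr flatten.
apply/eq_in_map => i; rewrite mem_iota => /andP[i_gt0 _] /=.
by rewrite row_len_cat_raise.
Qed.

Lemma diagram_below (la : seq nat) (u : cell) :
  sorted geq la -> 1 < u.1 -> u \in diagram la -> (u.1.-1, u.2) \in diagram la.
Proof.
move=> la_sorted u_above; rewrite !mem_diagram /= => u_in.
have geq_trans : transitive geq.
  by move=> y x z /= xy yz; exact: leq_trans yz xy.
have : row_len la u.1 <= row_len la u.1.-1.
  by apply: (sorted_leq_nth geq_trans leqnn 0 la_sorted); rewrite ?inE; lia.
by lia.
Qed.

Lemma arm_cat (la nu : seq nat) (u : cell) :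
  u \in diagram la -> arm (la ++ nu) u = arm la u.
Proof. by rewrite mem_diagram /arm => /andP[hu _]; rewrite row_len_cat. Qed.

Lemma arm_raise (la nu : seq nat) (u : cell) :
  u \in diagram nu -> arm (la ++ nu) (raise (size la) u) = arm nu u.
Proof.
by rewrite mem_diagram /arm => /andP[/andP[hu _] _]; rewrite row_len_cat_raise.
Qed.

Lemma leg_cat (la nu : seq nat) (u : cell) : u.1 <= size la ->
  leg (la ++ nu) u = leg la u + column_height nu u.2.
Proof.
move=> hu; rewrite /leg diagram_cat count_cat count_map; congr (_ + _).
apply: eq_in_count => -[i j]; rewrite mem_diagram /= => ij_in.
by rewrite (_ : u.1 < size la + i) ?andbT //; lia.
Qed.

Lemma leg_top (la : seq nat) (u : cell) : size la <= u.1 -> leg la u = 0.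
Proof.
move=> hu; apply/eqP; rewrite -leqn0 leqNgt -has_count; apply/hasPn => -[i j].
by rewrite mem_diagram /= => ij_in; lia.
Qed.

Lemma leg_raise (la nu : seq nat) (u : cell) :
  leg (la ++ nu) (raise (size la) u) = leg nu u.
Proof.
rewrite {1}/leg diagram_cat count_cat -/(leg la _) leg_top ?leq_addr //.
by rewrite count_map; apply: eq_count => v /=; rewrite ltn_add2l.
Qed.

Lemma column_height_cat (la nu : seq nat) (j : nat) :
  column_height (la ++ nu) j = column_height la j + column_height nu j.
Proof. by rewrite /column_height diagram_cat count_cat count_map. Qed.

Lemma column_height_row (n j : nat) : column_height [:: n] j = (0 < j <= n).
Proof.
rewrite /column_height /diagram /= cats0 count_map.
by rewrite (count_uniq_mem j (iota_uniq 1 n)) mem_iota.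
Qed.

Lemma column_height_nseq (l n j : nat) :
  column_height (nseq l n) j = l * (0 < j <= n).
Proof.
elim: l => [//|l IHl]; rewrite -[nseq _ _]/([:: n] ++ nseq l n).
by rewrite column_height_cat column_height_row IHl.
Qed.

Lemma leg_bottom (la : seq nat) (u : cell) :
  u \in diagram la -> u.1 = 1 -> leg la u + 1 = column_height la u.2.
Proof.
case: la => [//|n la]; rewrite mem_diagram => /[swap] u1; rewrite u1 /= => u2.
rewrite -cat1s leg_cat ?u1 // leg_top ?u1 //.
by rewrite column_height_cat column_height_row u2 addnC.
Qed.

Lemma attack_raise (k : nat) (u v : cell) :
  attack (raise k u) (raise k v) = attack u v.
Proof.
by case: u v => [i j] [i' j']; rewrite /attack /upper_right !xpair_eqE /=; lia.
Qed.

Lemma precedes_raise (k : nat) (u v : cell) :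
  precedes (raise k v) (raise k u) = precedes v u.
Proof. by rewrite /precedes /= ltn_add2l eqn_add2l. Qed.

Lemma precedes_raiseN (la nu : seq nat) (u v : cell) :
  u \in diagram la -> v \in diagram nu -> ~~ precedes u (raise (size la) v).
Proof. by rewrite !mem_diagram /precedes /=; lia. Qed.

Lemma Inv_sum (la : seq nat) (T : filling la) :
  Inv T = \sum_(u <- diagram la) \sum_(v <- diagram la) is_inversion T u v.
Proof.
rewrite /Inv /inversions size_filter -sum1_count big_mkcond big_allpairs_dep.
apply: eq_bigr => u _; apply: eq_bigr => v _.
by rewrite /is_inversion /=; case: ifP.
Qed.

Section Concatenation.

Variables (la nu : seq nat) (T : filling (la ++ nu)).
Variables (T' : filling la) (T'' : filling nu).
Hypothesis T'E : {in diagram la, entry T' =1 entry T}.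
Hypothesis T''E : {in diagram nu, forall u, T'' u = T (raise (size la) u)}.

Lemma Inv_cat : Inv T = Inv T' + Inv T'' + junction_Inv T la nu.
Proof.
rewrite !Inv_sum diagram_cat big_cat big_map addnAC -big_split /=.
congr (_ + _); apply: eq_big_seq => u u_in; rewrite big_cat big_map /=.
  by congr (_ + _); apply: eq_big_seq => v v_in; rewrite /is_inversion !T'E.
rewrite [X in X + _]big1_seq => [|v /andP[_ v_in]].
  apply: eq_big_seq => v v_in.
  by rewrite /is_inversion attack_raise precedes_raise !T''E.
by rewrite /is_inversion (negPf (precedes_raiseN v_in u_in)) !andbF.
Qed.

Hypotheses (la_sorted : sorted geq la) (nu_sorted : sorted geq nu).

Lemma is_descent_lower : {in diagram la, is_descent T =1 is_descent T'}.
Proof.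
move=> u u_in; rewrite /is_descent; case: ltnP => //= u_above.
by rewrite !T'E // diagram_below.
Qed.

Lemma is_descent_raise (u : cell) : u \in diagram nu ->
  is_descent T'' u = (1 < u.1) && is_descent T (raise (size la) u).
Proof.
move=> u_in; rewrite /is_descent; case: ltnP => //= u_above.
rewrite !T''E ?diagram_below // /raise /= (_ : 1 < size la + u.1); last by lia.
by rewrite (_ : (size la + u.1).-1 = size la + u.1.-1) //; lia.
Qed.

Lemma Des_cat :
  perm_eq (Des T)
    (Des T' ++ map (raise (size la)) (Des T'' ++ junction_descents T la nu)).
Proof.
rewrite {1}/Des diagram_cat filter_cat filter_map.
rewrite (eq_in_filter is_descent_lower) perm_cat2l perm_map //.
rewrite -(perm_filterC (fun u : cell => 1 < u.1)) -!filter_predI.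
rewrite /Des (eq_in_filter is_descent_raise) perm_cat2l.
rewrite /junction_descents (@eq_in_filter _ _ (fun u : cell =>
  (u.1 == 1) && is_descent T (raise (size la) u))) // => u.
by rewrite mem_diagram /= => u_in; congr (_ && _); lia.
Qed.

Lemma maj_cat :
  maj T = maj T' + maj T'' +
    \sum_(u <- Des T' ++ junction_descents T la nu) column_height nu u.2.
Proof.
have lower_terms : \sum_(u <- Des T') (leg (la ++ nu) u + 1) =
    maj T' + \sum_(u <- Des T') column_height nu u.2.
  rewrite -big_split; apply: eq_big_seq => u; rewrite mem_filter mem_diagram.
  by case/and3P=> _ /andP[_ u_le] _; rewrite leg_cat // addnAC.
have upper_terms : \sum_(u <- Des T'')
    (leg (la ++ nu) (raise (size la) u) + 1) = maj T''.
  by apply: eq_bigr => u _; rewrite leg_raise.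
have junction_terms : \sum_(u <- junction_descents T la nu)
    (leg (la ++ nu) (raise (size la) u) + 1) =
    \sum_(u <- junction_descents T la nu) column_height nu u.2.
  apply: eq_big_seq => u; rewrite mem_filter => /andP[/andP[/eqP u1 _] u_in].
  by rewrite leg_raise leg_bottom.
rewrite {1}/maj (perm_big _ Des_cat) big_cat big_map !big_cat /=.
by rewrite lower_terms upper_terms junction_terms addnACA addnA.
Qed.

Lemma sum_arm_cat :
  \sum_(u <- Des T) arm (la ++ nu) u =
  \sum_(u <- Des T') arm la u + \sum_(u <- Des T'') arm nu u +
  \sum_(u <- junction_descents T la nu) arm nu u.
Proof.
rewrite (perm_big _ Des_cat) big_cat big_map big_cat /= addnA.
congr (_ + _ + _); apply: eq_big_seq => u; rewrite mem_filter => /andP[_ u_in].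
- exact: arm_cat.
- exact: arm_raise.
- exact: arm_raise.
Qed.

Lemma inv_stat_cat :
  inv_stat T = (inv_stat T' + inv_stat T'' + ((junction_Inv T la nu)%:Z
    - (\sum_(u <- junction_descents T la nu) arm nu u)%:Z))%R.
Proof. by rewrite /inv_stat Inv_cat sum_arm_cat; lia. Qed.

End Concatenation.

Lemma mem_diagram_nseq1 (l : nat) (u : cell) :
  (u \in diagram (nseq l 1)) = (0 < u.1 <= l) && (u.2 == 1).
Proof. by rewrite mem_diagram size_nseq /row_len nth_nseq; case: ifP; lia. Qed.

Lemma arm_nseq1 (l : nat) (u : cell) :
  u \in diagram (nseq l 1) -> arm (nseq l 1) u = 0.
Proof. by rewrite mem_diagram_nseq1 /arm /row_len nth_nseq; case: ifP; lia. Qed.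

Lemma junction_Inv_nseq1 (f : cell -> nat) (la : seq nat) (l : nat) :
  junction_Inv f la (nseq l 1) = 0.
Proof.
apply: big1_seq => u /andP[_ u_in]; apply: big1_seq => v /andP[_ v_in].
move: u_in v_in; rewrite mem_diagram mem_diagram_nseq1.
by rewrite /is_inversion /attack /upper_right /=; lia.
Qed.

Theorem theorem3 (k l : nat) (hk : 1 <= k) (hl : 1 <= l)
    (mu' : seq nat) (hmu' : is_partition mu') (hsize : size mu' = k)
    (T : filling (mu' ++ nseq l 1))
    (T' : filling mu')
    (hT' : forall u : cell, u \in diagram mu' -> T' u = T u)
    (T'' : filling (nseq l 1))
    (hT'' : forall i : nat, 1 <= i <= l -> T'' (i, 1) = T (k + i, 1)) :
  maj T = maj T' + maj T'' %[mod l] /\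
  inv_stat T = (inv_stat T' + inv_stat T'')%R.
Proof.
have T''E : {in diagram (nseq l 1), forall u, T'' u = T (raise (size mu') u)}.
  move=> [i j]; rewrite mem_diagram_nseq1 hsize /= => /andP[hi /eqP->].
  exact: hT''.
have [mu'_sorted _] := andP hmu'.
have column_sorted : sorted geq (nseq l 1) := @sorted_nseq _ geq l 1 leqnn.
split.
  have heights_dvd (s : seq cell) :
      l %| \sum_(u <- s) column_height (nseq l 1) u.2.
    by apply: dvdn_sum => u _; rewrite column_height_nseq dvdn_mulr.
  by rewrite (maj_cat hT' T''E) // -modnDmr (eqP (heights_dvd _)) addn0.
have junction_arm0 :
    \sum_(u <- junction_descents T mu' (nseq l 1)) arm (nseq l 1) u = 0.
  by apply: big1_seq => u /andP[_]; rewrite mem_filter => /andP[_ /arm_nseq1].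
by rewrite (inv_stat_cat hT' T''E) // junction_Inv_nseq1 junction_arm0; lia.
Qed.
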